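(* Let $\hbar,\tau_p,\tau_w,\theta_0,\overline\kappa>0$ be constants, let $\overline n>0$ and $\overline g=\frac32\theta_0$. The full quantum hydrodynamics system, linearized around the constant equilibrium state $(\overline n,0,\overline g)$, i.e. the system for $U=(n,v,g)^\top\in\mathbb{R}^5$, $v\in\mathbb{R}^3$, $x\in\mathbb{R}^3$, $$n_t+\overline n\,\nabla\cdot v=0,$$ $$\overline n\,v_t+\tfrac23\overline g\,\nabla n+\tfrac23\overline n\,\nabla g+\tfrac{\overline n}{\tau_p}v=\tfrac{\hbar^2}{18}\nabla\Delta n,$$ $$\overline n\,g_t+\tfrac23\overline n\,\overline g\,\nabla\cdot v+\tfrac{\overline n}{\tau_w}g=\tfrac23\overline\kappa\Delta g+\tfrac{\overline\kappa\hbar^2}{36\,\overline n}\Delta^2n,$$ is not symbol symmetrizable.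
   Context: The nonlinear system is $\partial_tn+\nabla\cdot(nv)=0$, $\partial_t(nv)+\nabla\cdot(nv\otimes v-\mathbf P)=-\frac{nv}{\tau_p}$, $\partial_tW+\nabla\cdot(Wv-\mathbf Pv+q)=-\frac{1}{\tau_w}(W-\frac32n\theta_0)$, with $\mathbf P=-n\theta I_3+\frac{\hbar^2n}{12}\nabla\otimes\nabla\log n$, $W=\frac32n\theta+\frac12n|v|^2-\frac{\hbar^2n}{24}\Delta\log n$, $q=-\kappa\nabla\theta$, written in the state variables $(n,v,g)$ with $g=\frac32\theta-\frac{\hbar^2}{24}\Delta\log n$. The constant equilibrium states are exactly $(\overline n,0,\frac32\theta_0)$. After division by the constants multiplying the time derivatives the linear system has the form $U_t+\sum_{|\alpha|\le m}L^\alpha D^\alpha U=0$ with constant real $N\times N$ matrices. For $\xi\in\mathbb{R}^d\setminus\{0\}$, $\omega=\xi/|\xi|$, put $A(\xi)=\sum_{|\alpha|\text{ odd}}|\xi|^{|\alpha|-1}(-1)^{(|\alpha|-1)/2}\omega^\alpha L^\alpha$ and $B(\xi)=\sum_{|\alpha|\text{ even}}|\xi|^{|\alpha|}(-1)^{|\alpha|/2}\omega^\alpha L^\alpha$ (so $\widehat U_t+i|\xi|A\widehat U+B\widehat U=0$). Symbol symmetrizable: there is $S\in C^\infty(\mathbb{R}^d\setminus\{0\};\mathbb{R}^{N\times N})$ with $S(\xi)$ symmetric positive definite, $S(\xi)A(\xi)$ and $S(\xi)B(\xi)$ symmetric and $S(\xi)B(\xi)\ge0$ for all $\xi\neq0$.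 *)

(* Defs.v *)
From HB Require Import structures.
From mathcomp Require Import all_boot all_order all_algebra.
From mathcomp Require Import boolp classical_sets reals topology normedtype derive.
(* The notations of mpoly clash with those of the analysis files. *)
From mathcomp Require Import -(notations) mpoly.

Set Implicit Arguments.
Unset Strict Implicit.
Unset Printing Implicit Defensive.

Import Order.TTheory GRing.Theory Num.Theory.
Import numFieldNormedType.Exports.

Local Open Scope classical_set_scope.
Local Open Scope ring_scope.

Section Smoothness.
Variables (R : realType) (d : nat) (W : normedModType R).

(* The partial derivatives along the canonical basis, of every order up to k,
   exist and are continuous at every point of the open set O. *)
Fixpoint Ck_on (O : set 'rV[R]_d) (k : nat) (f : 'rV[R]_d -> W) : Prop :=
  (forall x, O x -> {for x, continuous f}) /\
  (if k is k'.+1 then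
     forall i : 'I_d, (forall x, O x -> derivable f x (delta_mx 0 i)) /\
                      Ck_on O k' (fun x => 'D_(delta_mx 0 i) f x)
   else True).

Definition smooth_on (O : set 'rV[R]_d) (f : 'rV[R]_d -> W) : Prop :=
  forall k, Ck_on O k f.

End Smoothness.

Section SymbolSymmetrizability.
Variables (R : realType) (d N : nat).

(* `|x| is the sup norm on 'rV[R]_d, not the Euclidean one. *)
Definition enorm (x : 'rV[R]_d) : R := Num.sqrt (\sum_(i < d) x 0 i ^+ 2).

Definition psd (M : 'M[R]_N) : Prop :=
  forall x : 'cV[R]_N, 0 <= (x^T *m M *m x) 0 0.

Definition posdef (M : 'M[R]_N) : Prop :=
  forall x : 'cV[R]_N, x != 0 -> 0 < (x^T *m M *m x) 0 0.

Definition symmetric (M : 'M[R]_N) : Prop := M^T = M.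

(* x^alpha *)
Definition monomial (x : 'rV[R]_d) (a : multinom d) : R :=
  \prod_(i < d) x 0 i ^+ a i.

(* A system U_t + \sum_(|alpha| <= m) L^alpha D^alpha U = 0 is given by its
   order m and its coefficients L; mdeg a is |alpha| and bmultinom d m.+1 is
   the finite type of the multi-indices with |alpha| < m.+1. *)
Variables (m : nat) (L : multinom d -> 'M[R]_N).

Definition odd_symbol (xi : 'rV[R]_d) : 'M[R]_N :=
  let omega := (enorm xi)^-1 *: xi in
  \sum_(a : bmultinom d m.+1 | odd (mdeg a))
    (enorm xi ^+ (mdeg a).-1 * (-1) ^+ (mdeg a).-1./2 * monomial omega a)
      *: L a.

Definition even_symbol (xi : 'rV[R]_d) : 'M[R]_N :=
  let omega := (enorm xi)^-1 *: xi in
  \sum_(a : bmultinom d m.+1 | ~~ odd (mdeg a))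
    (enorm xi ^+ mdeg a * (-1) ^+ (mdeg a)./2 * monomial omega a) *: L a.

Definition symbol_symmetrizable : Prop :=
  exists S : 'rV[R]_d -> 'M[R]_N,
    smooth_on [set xi | xi != 0] S /\
    forall xi : 'rV[R]_d, xi != 0 ->
      [/\ symmetric (S xi) /\ posdef (S xi),
          symmetric (S xi *m odd_symbol xi),
          symmetric (S xi *m even_symbol xi) &
          psd (S xi *m even_symbol xi)].

End SymbolSymmetrizability.

Section FullQuantumHydrodynamics.
Variables (R : realType) (hbar taup tauw kappa nbar gbar : R).

(* Constant-coefficient scalar differential operators on R^3 are represented
   by polynomials in the commuting indeterminates d/dx_1, d/dx_2, d/dx_3. *)
Local Notation diffop := (mpoly 3 R).
Local Notation "c %:op" := (mpolyC 3 c) (at level 2, format "c %:op").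

Definition partial (i : 'I_3) : diffop := mpolyX R (mnm1 i).
Definition gradient : 'cV[diffop]_3 := \col_i partial i.
Definition divergence : 'rV[diffop]_3 := \row_i partial i.
Definition laplacian : diffop := \sum_(i < 3) partial i ^+ 2.

(* With U = (n, v, g), the linearized system reads
     diag(time_coef) U_t + space_operator U = 0;
   the three block rows are the mass, momentum and energy equations, with all
   terms moved to the left-hand side. *)
Definition time_coef : 'rV[R]_(1 + 3 + 1) :=
  row_mx (row_mx (const_mx 1) (const_mx nbar)) (const_mx nbar).

Definition space_operator : 'M[diffop]_(1 + 3 + 1) :=
  col_mx
    (col_mx
      (row_mx (row_mx
         0
         (nbar%:op *: divergence))
         0)
      (row_mx (row_mx
         ((2 / 3 * gbar)%:op *: gradient
            - (hbar ^+ 2 / 18)%:op *: (laplacian *: gradient))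
         ((nbar / taup)%:op)%:M)
         ((2 / 3 * nbar)%:op *: gradient)))
    (row_mx (row_mx
       (- (kappa * hbar ^+ 2 / (36 * nbar))%:op * laplacian ^+ 2)%:M
       ((2 / 3 * nbar * gbar)%:op *: divergence))
       ((nbar / tauw)%:op - (2 / 3 * kappa)%:op * laplacian)%:M).

(* The matrices L^alpha, after division by the coefficients of U_t *)
Definition full_qhd_coef (a : multinom 3) : 'M[R]_(1 + 3 + 1) :=
  \matrix_(i, j) ((time_coef 0 i)^-1 * mcoeff a (space_operator i j)).

End FullQuantumHydrodynamics.

(* Main.v *)
(* Fix xi = r e_1 and number the unknowns (n, v, g) by 0, ..., 4.  With
   e = B_44 > 0 and B_40 = - c r^4 < 0, the symmetry of S B gives
   e S_04 = - c r^4 S_44, and the symmetry of S A gives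
   2/3 S_11 = nbar S_04 + 2/3 gbar S_44.  Since e grows only like r^2, the
   right-hand side is negative for large r, contradicting S_11 > 0. *)
Require Import Defs.
From mathcomp Require Import all_boot all_order all_algebra.
From mathcomp Require Import reals.
From mathcomp Require Import ring lra.
From mathcomp Require Import -(notations) mpoly.

Set Implicit Arguments.
Unset Strict Implicit.
Unset Printing Implicit Defensive.

Import Order.TTheory GRing.Theory Num.Theory.

Local Open Scope ring_scope.

(** * Parity-weighted evaluation of polynomial symbols *)

Section GradedEvaluation.
Variables (R : realType) (d m : nat) (Q : pred nat) (w : nat -> R).
Variable x : 'rV[R]_d.

(* The entries of both symbols are values of this functional: Q selects the
   parity of the degree and w carries the factor |xi|^k (-1)^(k/2). *)
Definition graded_eval (p : mpoly d R) : R :=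
  \sum_(a : bmultinom d m.+1 | Q (mdeg a))
    w (mdeg a) * monomial x a * mcoeff a p.

Lemma graded_evalD p q : graded_eval (p + q) = graded_eval p + graded_eval q.
Proof.
by rewrite /graded_eval -big_split; apply: eq_bigr => a _;
  rewrite mcoeffD mulrDr.
Qed.

Lemma graded_evalN p : graded_eval (- p) = - graded_eval p.
Proof.
by rewrite /graded_eval -sumrN; apply: eq_bigr => a _; rewrite mcoeffN mulrN.
Qed.

Lemma graded_eval0 : graded_eval 0 = 0.
Proof. by rewrite /graded_eval big1 // => a _; rewrite mcoeff0 mulr0. Qed.

(** On a homogeneous [p] every nonzero coefficient sits in degree [k], so the parity test and the
    weight are constant and leave the sum. The bound [k <= m] keeps all monomials of [p] within the
    truncation. *)
Lemma graded_eval_homog k (p : mpoly d R) :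
  p \is ishomog1 k mdeg -> (k <= m)%N ->
  graded_eval p = if Q k then w k * meval (x 0) p else 0.
Proof.
move=> hp km; have p0 (a : multinom d) : mdeg a != k -> mcoeff a p = 0.
  exact: dhomog_nemf_coeff.
case: ifP => Qk; last first.
  rewrite /graded_eval big1 // => a Qa.
  by rewrite p0 ?mulr0 //; apply: contraTneq Qa => ->; rewrite Qk.
(* [msize] is one more than the top degree, so this bound lets [mmapE] expand [meval] over the same
   index type [bmultinom d m.+1]. *)
have szp : (msize p <= m.+1)%N.
  rewrite mmeasureE; apply/bigmax_leqP_seq => a pa _; rewrite ltnS.
  by rewrite (dhomog_mf hp pa).
rewrite /meval (mmapE m.+1) // mulr_sumr /graded_eval big_mkcond.
apply: eq_bigr => a _.
case: (eqVneq (mdeg a) k) => [->|/p0->]; last by rewrite !(mulr0, mul0r) if_same.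
by rewrite Qk /mmap1 /monomial mulrAC -mulrA.
Qed.

End GradedEvaluation.

(** The quadratic form takes the value [M i i] at the i-th basis vector. *)
Lemma posdef_diag (R : realType) N (M : 'M[R]_N) (i : 'I_N) :
  posdef M -> 0 < M i i.
Proof.
move=> /(_ (delta_mx i 0)) Mpos; suff /Mpos : delta_mx i 0 != 0 :> 'cV[R]_N.
  by rewrite trmx_delta -rowE -colE !mxE.
by apply/eqP => /matrixP/(_ i 0)/eqP; rewrite !mxE !eqxx oner_eq0.
Qed.

Lemma enorm_delta (R : realType) d (i : 'I_d) (r : R) :
  0 <= r -> enorm (r *: delta_mx 0 i) = r.
Proof.
move=> r_ge0; rewrite /enorm (bigD1 i) //= big1 ?addr0 => [|j /negPf ij].
  by rewrite !mxE !eqxx mulr1 sqrtr_sqr ger0_norm.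
by rewrite !mxE ij andbF mulr0 expr0n.
Qed.

(** * Degrees and values of the basic differential operators *)

Section Homogeneity.
Variable R : realType.

Lemma partial_homog (i : 'I_3) : partial R i \is ishomog1 1 mdeg.
Proof. by rewrite dhomogX; apply/eqP; exact: mdeg1. Qed.

Lemma laplacian_homog : laplacian R \is ishomog1 2 mdeg.
Proof.
by apply: rpred_sum => i _; apply: (@dhomogMn _ _ mdeg 1); exact: partial_homog.
Qed.

Lemma mpolyC_homog (c : R) : mpolyC 3 c \is ishomog1 0 mdeg.
Proof. by rewrite -[mpolyC _ _]mulr1 mul_mpolyC; apply/dhomogZ/dhomog1. Qed.

Lemma mulC_homog (c : R) k (p : mpoly 3 R) :
  p \is ishomog1 k mdeg -> mpolyC 3 c * p \is ishomog1 k mdeg.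
Proof. by rewrite mul_mpolyC; exact: dhomogZ. Qed.

Lemma meval_partial (x : 'rV[R]_3) i : meval (x 0) (partial R i) = x 0 i.
Proof. exact: mevalXU. Qed.

Lemma meval_laplacian (i : 'I_3) :
  meval ((delta_mx 0 i : 'rV[R]_3) 0) (laplacian R) = 1.
Proof.
rewrite raddf_sum (bigD1 i) //= big1 ?addr0 => [|j /negPf ij].
  by rewrite rmorphXn /= meval_partial mxE !eqxx expr1n.
by rewrite rmorphXn /= meval_partial mxE ij andbF expr0n.
Qed.

End Homogeneity.

(** * Entries of the two symbols on the ray through the first basis vector *)

Section Symbols.
Variables (R : realType) (hbar taup tauw kappa nbar gbar r : R).
Hypothesis r_gt0 : 0 < r.
Hypothesis nbar_gt0 : 0 < nbar.

Local Notation L := (full_qhd_coef hbar taup tauw kappa nbar gbar).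
Local Notation P := (space_operator hbar taup tauw kappa nbar gbar).
Local Notation xi := (r *: delta_mx 0 0 : 'rV[R]_3).
Local Notation A := (odd_symbol 4 L xi).
Local Notation B := (even_symbol 4 L xi).

(** The indices follow the block nesting of [space_operator], so its entries are read off with the
    [row_mx] and [col_mx] lemmas. *)
Definition idx_n : 'I_(1 + 3 + 1) := lshift 1 (lshift 3 0).
Definition idx_v (i : 'I_3) : 'I_(1 + 3 + 1) := lshift 1 (rshift 1 i).
Definition idx_g : 'I_(1 + 3 + 1) := rshift (1 + 3) 0.

Lemma sum_idx (F : 'I_(1 + 3 + 1) -> R) :
  \sum_i F i = F idx_n + \sum_i F (idx_v i) + F idx_g.
Proof. by rewrite !big_split_ord /= !big_ord1. Qed.

Lemma time_coef_n : time_coef nbar 0 idx_n = 1.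
Proof. by rewrite !row_mxEl mxE. Qed.

Lemma time_coef_v i : time_coef nbar 0 (idx_v i) = nbar.
Proof. by rewrite row_mxEl row_mxEr mxE. Qed.

Lemma time_coef_g : time_coef nbar 0 idx_g = nbar.
Proof. by rewrite row_mxEr mxE. Qed.

(** The direction is the first basis vector, so the radius [r] enters only through the weight. The
    order 4 is that of the squared Laplacian. *)
Definition odd_eval : mpoly 3 R -> R :=
  graded_eval 4 odd (fun k => r ^+ k.-1 * (-1) ^+ k.-1./2) (delta_mx 0 0).

Definition even_eval : mpoly 3 R -> R :=
  graded_eval 4 (fun k => ~~ odd k) (fun k => r ^+ k * (-1) ^+ k./2)
    (delta_mx 0 0).

Lemma omegaE : (enorm xi)^-1 *: xi = delta_mx 0 0.
Proof. by rewrite enorm_delta ?ltW // scalerA mulVf ?scale1r // gt_eqF. Qed.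

Lemma odd_symbolE i j : A i j = (time_coef nbar 0 i)^-1 * odd_eval (P i j).
Proof.
rewrite /odd_symbol omegaE enorm_delta ?ltW // summxE mulr_sumr.
by apply: eq_bigr => a _; rewrite !mxE mulrCA.
Qed.

Lemma even_symbolE i j : B i j = (time_coef nbar 0 i)^-1 * even_eval (P i j).
Proof.
rewrite /even_symbol omegaE enorm_delta ?ltW // summxE mulr_sumr.
by apply: eq_bigr => a _; rewrite !mxE mulrCA.
Qed.

Lemma space_operator_nv j : P idx_n (idx_v j) = mpolyC 3 nbar * partial R j.
Proof. by rewrite !col_mxEu row_mxEl row_mxEr !mxE. Qed.

Lemma space_operator_ng : P idx_n idx_g = 0.
Proof. by rewrite !col_mxEu row_mxEr mxE. Qed.

Lemma space_operator_nn : P idx_n idx_n = 0.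
Proof. by rewrite !col_mxEu !row_mxEl mxE. Qed.

Lemma space_operator_vn i :
  P (idx_v i) idx_n = mpolyC 3 (2 / 3 * gbar) * partial R i
    - mpolyC 3 (hbar ^+ 2 / 18) * (laplacian R * partial R i).
Proof. by rewrite col_mxEu col_mxEd !row_mxEl !mxE. Qed.

Lemma space_operator_vv i j :
  P (idx_v i) (idx_v j) = mpolyC 3 (nbar / taup) *+ (i == j).
Proof. by rewrite col_mxEu col_mxEd row_mxEl row_mxEr !mxE. Qed.

Lemma space_operator_vg i :
  P (idx_v i) idx_g = mpolyC 3 (2 / 3 * nbar) * partial R i.
Proof. by rewrite col_mxEu col_mxEd row_mxEr !mxE. Qed.

Lemma space_operator_gn :
  P idx_g idx_n =
    - (mpolyC 3 (kappa * hbar ^+ 2 / (36 * nbar)) * laplacian R ^+ 2).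
Proof. by rewrite col_mxEd !row_mxEl mxE eqxx mulr1n mulNr. Qed.

Lemma space_operator_gv j :
  P idx_g (idx_v j) = mpolyC 3 (2 / 3 * nbar * gbar) * partial R j.
Proof. by rewrite col_mxEd row_mxEl row_mxEr !mxE. Qed.

Lemma space_operator_gg :
  P idx_g idx_g =
    mpolyC 3 (nbar / tauw) - mpolyC 3 (2 / 3 * kappa) * laplacian R.
Proof. by rewrite col_mxEd row_mxEr mxE eqxx. Qed.

(** In degree one the weight is r^0 (-1)^0 = 1, hence no dependence on [r]. *)
Lemma odd_eval_partial c i :
  odd_eval (mpolyC 3 c * partial R i) = c * (i == 0)%:R.
Proof.
rewrite /odd_eval (@graded_eval_homog _ _ _ _ _ _ 1) //=; last first.
  exact/mulC_homog/partial_homog.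
by rewrite !mul1r mevalM mevalC meval_partial mxE.
Qed.

Lemma even_eval_odd k (p : mpoly 3 R) :
  p \is ishomog1 k mdeg -> (k <= 4)%N -> odd k -> even_eval p = 0.
Proof. by move=> hp k4 ok; rewrite /even_eval (graded_eval_homog _ _ _ hp) ?ok. Qed.

Lemma odd_eval_even k (p : mpoly 3 R) :
  p \is ishomog1 k mdeg -> (k <= 4)%N -> ~~ odd k -> odd_eval p = 0.
Proof.
by move=> hp k4 ok; rewrite /odd_eval (graded_eval_homog _ _ _ hp) ?(negPf ok).
Qed.

(** * Columns v and g of [A], then columns n and g of [B]: those entering the two symmetry
    relations *)

Lemma odd_symbol_ng : A idx_n idx_g = 0.
Proof. by rewrite odd_symbolE space_operator_ng /odd_eval graded_eval0 mulr0. Qed.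

Lemma odd_symbol_vg i : A (idx_v i) idx_g = 2 / 3 * (i == 0)%:R.
Proof.
rewrite odd_symbolE space_operator_vg odd_eval_partial time_coef_v.
by field; rewrite gt_eqF.
Qed.

Lemma odd_symbol_gg : A idx_g idx_g = 0.
Proof.
rewrite odd_symbolE space_operator_gg /odd_eval graded_evalD graded_evalN.
rewrite -!/(odd_eval _) (odd_eval_even (mpolyC_homog _)) //.
by rewrite (odd_eval_even (mulC_homog _ (laplacian_homog R))) // subr0 mulr0.
Qed.

Lemma odd_symbol_nv j : A idx_n (idx_v j) = nbar * (j == 0)%:R.
Proof.
by rewrite odd_symbolE space_operator_nv odd_eval_partial time_coef_n invr1 mul1r.
Qed.

Lemma odd_symbol_vv i j : A (idx_v i) (idx_v j) = 0.
Proof.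
rewrite odd_symbolE space_operator_vv.
by rewrite (@odd_eval_even 0) ?mulr0 // rpredMn // mpolyC_homog.
Qed.

Lemma odd_symbol_gv j : A idx_g (idx_v j) = 2 / 3 * gbar * (j == 0)%:R.
Proof.
rewrite odd_symbolE space_operator_gv odd_eval_partial time_coef_g.
by field; rewrite gt_eqF.
Qed.

Lemma even_symbol_nn : B idx_n idx_n = 0.
Proof. by rewrite even_symbolE space_operator_nn /even_eval graded_eval0 mulr0. Qed.

(** The pressure term has order one and the quantum term order three, both odd. *)
Lemma even_symbol_vn i : B (idx_v i) idx_n = 0.
Proof.
rewrite even_symbolE space_operator_vn /even_eval graded_evalD graded_evalN.
rewrite -!/(even_eval _) (even_eval_odd (mulC_homog _ (partial_homog _ _))) //.
rewrite (@even_eval_odd 3) ?subr0 ?mulr0 //.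
exact/mulC_homog/(dhomogM (laplacian_homog R) (partial_homog _ _)).
Qed.

(** In degree four the weight is +r^4, so the minus sign of the operator survives; division by the
    time coefficient turns [nbar] into its square. *)
Lemma even_symbol_gn :
  B idx_g idx_n = - (kappa * hbar ^+ 2 / (36 * nbar ^+ 2) * r ^+ 4).
Proof.
rewrite even_symbolE space_operator_gn /even_eval graded_evalN time_coef_g.
rewrite (@graded_eval_homog _ _ _ _ _ _ 4) //=; last first.
  exact/mulC_homog/(dhomogMn 2 (laplacian_homog R)).
rewrite mevalM mevalC rmorphXn /= meval_laplacian.
by field; rewrite gt_eqF.
Qed.

Lemma even_symbol_ng : B idx_n idx_g = 0.
Proof. by rewrite even_symbolE space_operator_ng /even_eval graded_eval0 mulr0. Qed.

Lemma even_symbol_vg i : B (idx_v i) idx_g = 0.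
Proof.
rewrite even_symbolE space_operator_vg.
by rewrite (even_eval_odd (mulC_homog _ (partial_homog _ _))) // mulr0.
Qed.

(** The degree-two weight -r^2 cancels the minus sign of heat conduction, so growth in [r] is only
    quadratic. *)
Lemma even_symbol_gg :
  B idx_g idx_g = tauw^-1 + 2 / 3 * kappa / nbar * r ^+ 2.
Proof.
rewrite even_symbolE space_operator_gg /even_eval graded_evalD graded_evalN.
rewrite time_coef_g (graded_eval_homog _ _ _ (mpolyC_homog _)) //=.
rewrite (graded_eval_homog _ _ _ (mulC_homog _ (laplacian_homog R))) //=.
rewrite mevalM !mevalC meval_laplacian.
(* Naming the inverse makes it an atom for [field], which would otherwise ask for [tauw != 0]. *)
set t := tauw^-1; by field; rewrite gt_eqF.
Qed.

End Symbols.

(** * The contradiction at large radius *)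

Lemma symmetricE (R : realType) N (M : 'M[R]_N) i j :
  Defs.symmetric M -> M i j = M j i.
Proof. by move=> MT; rewrite -[in LHS]MT mxE. Qed.

(** A quartic dominates a quadratic. The witness is 1 + u, where n c u = b (e0 + e1). *)
Lemma large_radius (R : realType) (b e0 e1 c n : R) :
  0 < b -> 0 < e0 -> 0 < e1 -> 0 < c -> 0 < n ->
  exists2 r, 0 < r & b * (e0 + e1 * r ^+ 2) <= n * (c * r ^+ 4).
Proof.
move=> b0 e00 e10 c0 n0; set u := (b * e0 + b * e1) / (n * c).
have u0 : 0 < u by rewrite divr_gt0 ?addr_gt0 ?mulr_gt0.
exists (1 + u); first by lra.
have -> : b * (e0 + e1 * (1 + u) ^+ 2) = b * e0 + b * e1 * (1 + u) ^+ 2 by ring.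
have -> : n * (c * (1 + u) ^+ 4) = n * c * (1 + u) ^+ 4 by ring.
have uE : b * e0 = n * c * u - b * e1 by rewrite /u; field; rewrite !gt_eqF.
have le1 : b * e1 <= n * c * u by move: (mulr_gt0 b0 e00); lra.
have q1 : 1 + u <= (1 + u) ^+ 2 by nra.
have nc0 : 0 < n * c by rewrite mulr_gt0.
set q := (1 + u) ^+ 2 in q1 *.
have -> : (1 + u) ^+ 4 = q * q by rewrite /q; ring.
rewrite uE.
(* With q >= 1 and q >= u, [h] gives b e0 + b e1 q <= n c u q, and [h2] gives n c u q <= n c q^2. *)
have h : 0 <= (q - 1) * (n * c * u - b * e1) by rewrite mulr_ge0; lra.
have h2 : 0 <= n * c * (q * (q - u)) by rewrite !mulr_ge0; lra.
nra.
Qed.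

Theorem proposition6p2 (R : realType)
    (hbar taup tauw theta0 kappabar nbar gbar : R)
    (hbar_gt0 : 0 < hbar) (taup_gt0 : 0 < taup) (tauw_gt0 : 0 < tauw)
    (theta0_gt0 : 0 < theta0) (kappabar_gt0 : 0 < kappabar)
    (nbar_gt0 : 0 < nbar) (gbarE : gbar = 3 / 2 * theta0) :
  ~ symbol_symmetrizable 4
      (full_qhd_coef hbar taup tauw kappabar nbar gbar).
Proof.
case=> S [_ symS].
have gbar_gt0 : 0 < gbar by rewrite gbarE; lra.
(* [b] is the entry of [A] in row g and column v_1; the entries of [B] in row g are -c r^4 in column
   n and tauw^-1 + e1 r^2 in column g. *)
pose b := 2 / 3 * gbar; pose c := kappabar * hbar ^+ 2 / (36 * nbar ^+ 2).
pose e1 := 2 / 3 * kappabar / nbar.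
have b_gt0 : 0 < b by rewrite /b; lra.
have c_gt0 : 0 < c by rewrite !(divr_gt0, mulr_gt0, exprn_gt0, ltr0n).
have e1_gt0 : 0 < e1 by rewrite !(divr_gt0, mulr_gt0, ltr0n).
have e0_gt0 : 0 < tauw^-1 by rewrite invr_gt0.
have [r r_gt0 large] := large_radius b_gt0 e0_gt0 e1_gt0 c_gt0 nbar_gt0.
have xi_neq0 : r *: delta_mx 0 0 != 0 :> 'rV[R]_3.
  apply/eqP => /matrixP/(_ 0 0)/eqP.
  by rewrite !mxE !eqxx mulr1 gt_eqF.
have [[Ssym Spos] SA SB _] := symS _ xi_neq0.
move: Ssym Spos SA SB; set T := S _ => Ssym Spos SA SB.
have Tv := posdef_diag (idx_v 0) Spos; have Tg := posdef_diag idx_g Spos.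
have := symmetricE idx_n idx_g SB; have := symmetricE (idx_v 0) idx_g SA.
rewrite !mxE !sum_idx.
rewrite odd_symbol_ng // odd_symbol_gg // odd_symbol_nv // odd_symbol_gv //.
rewrite even_symbol_ng // even_symbol_gg // even_symbol_nn // even_symbol_gn //.
rewrite !big_ord_recl !big_ord0.
rewrite !odd_symbol_vg // !odd_symbol_vv // !even_symbol_vg // !even_symbol_vn //.
(* Symmetry of [T] identifies its two n-g entries, so both relations share the unknown [s]. *)
rewrite /= (symmetricE idx_g idx_n Ssym) -/b -/c -/e1.
set s := T idx_n idx_g; set e := tauw^-1 + _ in large *.
move: Tv Tg; set tv := T _ _; set tg := T _ _ => Tv Tg SA41 SB04.
have e_gt0 : 0 < e by rewrite addr_gt0 // mulr_gt0 // exprn_gt0.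
have sE : s * e = - (tg * (c * r ^+ 4)) by lra.
have tvE : 2 / 3 * tv = nbar * s + b * tg by lra.
(* Multiplying by [e] eliminates [s] through [sE]; what remains is [tg] times a factor that [large]
   makes nonpositive. *)
have : 0 < (nbar * s + b * tg) * e by rewrite -tvE mulr_gt0 //; lra.
have -> : (nbar * s + b * tg) * e = tg * (b * e - nbar * (c * r ^+ 4)).
  by rewrite mulrDl -mulrA sE; ring.
by rewrite pmulr_rgt0 // subr_gt0 ltNge large.
Qed.
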